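(* Consider the bilevel representation learning problem $$\min_{W_1,\,W_2\in\mathcal{S}(W_1)}\tfrac12\|Y_{\rm val}-X_{\rm val}W_1W_2\|^2\quad\text{s.t.}\quad \mathcal{S}(W_1)=\arg\min_{W_2}\tfrac12\|Y_{\rm trn}-X_{\rm trn}W_1W_2\|^2 ,$$ and let $X_\gamma=[X_{\rm val};\sqrt\gamma X_{\rm trn}]$ be the concatenated data matrix. Suppose that for any $\epsilon_1,\epsilon_2\in\mathbb{R}_{\ge0}$ there exists an $(\epsilon_1,\epsilon_2)$ solution $(W_1^*,W_2^* )$ to this problem such that $\mathsf{L}_{\rm trn}(W_1^*,W_2^* )-\min_{W_1,W_2}\mathsf{L}_{\rm trn}(W_1,W_2)\le\epsilon_2$. Let $(W_1^k,W_2^k)$ be iterates of PBGD in Jacobi fashion. If $\sigma_{\min}^2(W_1^k)>0$ and $\sigma_{\min}^2(W_2^k)>0$, then the joint PL inequality holds with $\mu_k=(\sigma_{\min}^2(W_1^k)+\sigma_{\min}^2(W_2^k))\sigma_*^2(X_\gamma)$, that is, $$\|\nabla\mathsf{L}_\gamma(W_1^k,W_2^k)\|^2\ge2\mu_k\big(\mathsf{L}_\gamma(W_1^k,W_2^k)-\min_{W_1,W_2}\mathsf{L}_\gamma(W_1,W_2)\big),$$ and the following descent inequality holds: $$\mathsf{L}_\gamma(W_1^{k+1},W_2^{k+1})\le\mathsf{L}_\gamma(W_1^k,W_2^k)-\Big(\frac\alpha2-\alpha^2L_k\Big)\|\nabla\mathsf{L}_\gamma(W_1^k,W_2^k)\|^2+\Big(\frac\alpha2+\alpha^2L_k\Big)\|\delta_k\|^2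 .$$
   Context: Setting. $X_{\rm trn}\in\mathbb{R}^{N\times m}$, $X_{\rm val}\in\mathbb{R}^{N'\times m}$, $Y_{\rm trn}\in\mathbb{R}^{N\times n}$, $Y_{\rm val}\in\mathbb{R}^{N'\times n}$, $W_1\in\mathbb{R}^{m\times h}$, $W_2\in\mathbb{R}^{h\times n}$, $\gamma>0$. Standing assumptions: $m\ge\max\{N,N'\}$, $h\ge\max\{m,n\}$, and $X_{\rm trn},X_{\rm val}$ have full row rank. $\|\cdot\|$ is the Frobenius norm; $\sigma_{\max},\sigma_{\min},\sigma_*$ are the largest singular value, the smallest singular value (the $\min\{p,q\}$-th for a $p\times q$ matrix), and the smallest nonzero singular value. $[A;B]$ is vertical concatenation. $\mathsf{L}_{\rm trn}(W_1,W_2)=\frac12\|Y_{\rm trn}-X_{\rm trn}W_1W_2\|^2$, $\mathsf{L}_{\rm val}(W_1,W_2)=\frac12\|Y_{\rm val}-X_{\rm val}W_1W_2\|^2$, $\mathsf{L}^*_{\rm trn}(W_1)=\min_{W_2}\mathsf{L}_{\rm trn}(W_1,W_2)$, $\mathsf{L}_\gamma(W_1,W_2)=\mathsf{L}_{\rm val}(W_1,W_2)+\gamma(\mathsf{L}_{\rm trn}(W_1,W_2)-\mathsf{L}^*_{\rm trn}(W_1))$, $\mathsf{L}_\gamma^*=\min_{W_1,W_2}\mathsf{L}_\gamma(W_1,W_2)$. $(\epsilon_1,\epsilon_2)$ solution: a point $(W_1^*,W_2^* )$ with $\mathsf{L}_{\rm trn}(W_1^*,W_2^* )-\mathsf{L}^*_{\rm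 trn}(W_1^* )\le\epsilon_2$ such that for every $(W_1,W_2)$ with $\mathsf{L}_{\rm trn}(W_1,W_2)-\mathsf{L}^*_{\rm trn}(W_1)\le\epsilon_2$ one has $\mathsf{L}_{\rm val}(W_1^*,W_2^* )\le\mathsf{L}_{\rm val}(W_1,W_2)+\epsilon_1$. PBGD in Jacobi fashion, from initialization $W_1^0,W_2^0,W_3^0$ with stepsizes $\alpha,\beta$: at iteration $k$, starting at $W_3^{k,0}=W_3^0$, run $W_3^{k,t+1}=W_3^{k,t}-\beta\nabla_{W_2}\mathsf{L}_{\rm trn}(W_1^k,W_3^{k,t})$ for $T_k$ steps, set $W_3^{k+1}=W_3^{k,T_k}$, and then $W_1^{k+1}=W_1^k-\alpha\big(\nabla_{W_1}\mathsf{L}_{\rm val}(W_1^k,W_2^k)+\gamma(\nabla_{W_1}\mathsf{L}_{\rm trn}(W_1^k,W_2^k)-\nabla_{W_1}\mathsf{L}_{\rm trn}(W_1^k,W_3^{k+1}))\big)$, $W_2^{k+1}=W_2^k-\alpha\big(\nabla_{W_2}\mathsf{L}_{\rm val}(W_1^k,W_2^k)+\gamma\nabla_{W_2}\mathsf{L}_{\rm trn}(W_1^k,W_2^k)\big)$. Gradient estimation error: $\delta_k=\gamma(\nabla\mathsf{L}^*_{\rm trn}(W_1^k)-\nabla_{W_1}\mathsf{L}_{\rm trn}(W_1^k,W_3^{k+1}))$. Local smoothness constant: with $\delta=\|\delta_k\|$, $S=\sigma_{\max}^2(X_\gamma)$, $a_k=\sigma_{\max}^2(W_1^k)+\sigma_{\max}^2(W_2^k)$,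 $G_k=\mathsf{L}_\gamma(W_1^k,W_2^k)-\mathsf{L}_\gamma^*$, $W^k=W_1^kW_2^k$, $$L_k=S a_k+3\alpha\delta S\sigma_{\max}(W_2^k)+(1+3\alpha S a_k)\sqrt{2SG_k}+3\alpha^2S\delta\,\sigma_{\max}(W_1^k)\sqrt{2SG_k}+6\alpha^2S^2\sigma_{\max}(W^k)G_k .$$ *)

(* Defs.v *)
From HB Require Import structures.
From mathcomp Require Import all_boot all_order all_algebra.
From mathcomp Require Import all_classical all_reals all_analysis.
From mathcomp Require Import complex spectral.
Import Order.TTheory GRing.Theory Num.Theory.
Import numFieldNormedType.Exports.

Set Implicit Arguments.
Unset Strict Implicit.
Unset Printing Implicit Defensive.

Local Open Scope classical_set_scope.
Local Open Scope ring_scope.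
Local Open Scope sesquilinear_scope.

Section MatrixAnalysis.
Variable R : realType.

(* The norm [`|A|] that the library puts on matrices is the sup norm, hence
   this separate definition. *)
Definition fnorm p q (A : 'M[R]_(p, q)) : R :=
  Num.sqrt (\sum_i \sum_j A i j ^+ 2).

(* Matrix of partial derivatives. The library's topology on matrices is the
   product topology, so this is the gradient for the Frobenius inner product
   wherever f is differentiable. *)
Definition grad p q (f : 'M[R]_(p, q) -> R) (A : 'M[R]_(p, q)) :
    'M[R]_(p, q) :=
  \matrix_(i, j) 'D_(delta_mx i j) (f : 'M[R]_(p, q) -> R^o) A.

(* Squared Frobenius norm of the gradient of f with respect to both
   arguments jointly. *)
Definition joint_grad_sqnorm p q r s
    (f : 'M[R]_(p, q) -> 'M[R]_(r, s) -> R) A B : R :=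
  fnorm (grad (fun A' => f A' B) A) ^+ 2 + fnorm (grad (f A) B) ^+ 2.

(* The q numbers sqrt (lambda_i) in nonincreasing order, where the lambda_i
   are the eigenvalues of A^T A with multiplicity. Exactly one sequence s
   satisfies these conditions; only its first [minn p q] terms can be
   nonzero. *)
Definition gram_roots p q (A : 'M[R]_(p, q)) : set (seq R) :=
  [set s | [/\ sorted >=%R s, all (>= 0) s
             & char_poly (A^T *m A) = \prod_(a <- s) ('X - (a ^+ 2)%:P)]].

Lemma gram_roots_ex p q (A : 'M[R]_(p, q)) :
  exists s, gram_roots A s.
Proof.
pose B : 'M[R[i]]_q := map_mx (real_complex R) (A^T *m A).
have Bconj : map_mx Num.conj B = B.
  by apply/matrixP => i j; rewrite !mxE conj_Creal // complex_real.
have Bsym : B^T = B by rewrite /B map_trmx trmx_mul trmxK.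
have Bh : B \is hermsymmx.
  apply/is_hermitianmxP; rewrite expr0 scale1r.
  by rewrite Bsym; apply/esym.
have Bn := hermitian_normalmx Bh.
have dreal := hermitian_spectral_diag_real Bh.
have BE := elimT (@orthomx_spectralP _ _ B) Bn.
have Pu : spectralmx B \is unitarymx := spectral_unitarymx B.
set P := spectralmx B in BE Pu; set d := spectral_diag B in BE dreal.
have Punit := unitarymx_unit Pu.
have d_ge0 i : 0 <= d 0 i.
  have E : diag_mx d = P *m B *m P ^t*.
    by rewrite -invmx_unitary // BE !mulmxA mulmxV // mul1mx mulmxK.
  pose AC := map_mx (real_complex R) A.
  have BA : B = AC ^t* *m AC.
    rewrite /B /AC map_mxM map_trmx; congr (_ *m _).
    by apply/matrixP => a b; rewrite !mxE conj_Creal // complex_real.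
  have -> : d 0 i = diag_mx d i i by rewrite mxE eqxx mulr1n.
  rewrite E BA.
  have -> : P *m (AC ^t* *m AC) *m P ^t* = (P *m AC ^t*) *m (P *m AC ^t*) ^t*.
    by rewrite trmx_mul map_mxM /= trmxCK !mulmxA.
  rewrite mxE sumr_ge0 // => k _.
  by rewrite [X in _ * X]mxE [X in _ * Num.conj X]mxE mul_conjC_ge0.
pose t := sort >=%R [seq Num.sqrt (complex.Re (d 0 i)) | i <- enum 'I_q].
exists t; split.
- by apply: sort_sorted => x y; exact: le_total.
- by rewrite all_sort; apply/allP => x /mapP[i _ ->] /=; exact: sqrtr_ge0.
rewrite (perm_big _ (permEl (perm_sort _ _))) /= big_map big_enum /=.
apply: (@map_inj_poly _ _ (real_complex R)); [exact: fmorph_inj|by rewrite rmorph0|].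
rewrite map_char_poly -/B.
have -> : char_poly B = char_poly (diag_mx d).
  rewrite BE /char_poly /char_poly_mx !map_mxM /=.
  have -> : 'X%:M - map_mx polyC (invmx P) *m map_mx polyC (diag_mx d)
                    *m map_mx polyC P
          = map_mx polyC (invmx P) *m ('X%:M - map_mx polyC (diag_mx d))
            *m map_mx polyC P.
    rewrite mulmxBr mulmxBl; congr (_ - _).
    by rewrite scalar_mxC -mulmxA -map_mxM mulVmx // map_mx1 mulmx1.
  rewrite !det_mulmx mulrC mulrA -det_mulmx -map_mxM mulmxV // map_mx1 det1 mul1r //.
rewrite rmorph_prod /= char_poly_trig ?diag_mx_is_trig //.
apply: eq_bigr => i _; rewrite rmorphB /= map_polyX map_polyC /= mxE eqxx mulr1n.
congr (_ - _%:P).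
have := d_ge0 i; case: (d 0 i) => a b; rewrite lecE /= => /andP[/eqP-> a0].
by rewrite sqr_sqrtr.
Qed.

Definition singular_values p q (A : 'M[R]_(p, q)) : seq R :=
  take (minn p q) (xget [::] (gram_roots A)).

Definition sigma_max p q (A : 'M[R]_(p, q)) : R := head 0 (singular_values A).

Definition sigma_min p q (A : 'M[R]_(p, q)) : R :=
  nth 0 (singular_values A) (minn p q).-1.

(* Smallest nonzero singular value ([0] if A = 0). *)
Definition sigma_star p q (A : 'M[R]_(p, q)) : R :=
  last 0 [seq a <- singular_values A | a != 0].

End MatrixAnalysis.

Record bilevel_data (R : realType) (N N' m n : nat) := BilevelData {
  Xtrn : 'M[R]_(N, m);
  Xval : 'M[R]_(N', m);
  Ytrn : 'M[R]_(N, n);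
  Yval : 'M[R]_(N', n) }.

Section Bilevel.
Variables (R : realType) (N N' m n h : nat) (D : bilevel_data R N N' m n).
Local Notation M1 := 'M[R]_(m, h).
Local Notation M2 := 'M[R]_(h, n).

Definition Ltrn (W1 : M1) (W2 : M2) : R :=
  2^-1 * fnorm (Ytrn D - Xtrn D *m W1 *m W2) ^+ 2.

Definition Lval (W1 : M1) (W2 : M2) : R :=
  2^-1 * fnorm (Yval D - Xval D *m W1 *m W2) ^+ 2.

(* All minima of losses are taken as infima over the whole space; every
   function involved is bounded below by 0, so this is the minimum whenever
   a minimum is attained. *)
Definition Ltrn_star (W1 : M1) : R := inf (range (Ltrn W1)).

Definition joint_min (f : M1 -> M2 -> R) : R :=
  inf (range (fun W : M1 * M2 => f W.1 W.2)).

Definition Lgamma (gamma : R) (W1 : M1) (W2 : M2) : R :=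
  Lval W1 W2 + gamma * (Ltrn W1 W2 - Ltrn_star W1).

Definition Xgamma (gamma : R) : 'M[R]_(N' + N, m) :=
  col_mx (Xval D) (Num.sqrt gamma *: Xtrn D).

Definition eps_solution (eps1 eps2 : R) (W1s : M1) (W2s : M2) : Prop :=
  Ltrn W1s W2s - Ltrn_star W1s <= eps2 /\
  forall W1 W2, Ltrn W1 W2 - Ltrn_star W1 <= eps2 ->
    Lval W1s W2s <= Lval W1 W2 + eps1.

Definition gradW1 (L : M1 -> M2 -> R) (W1 : M1) (W2 : M2) :=
  grad (fun W => L W W2) W1.

Definition gradW2 (L : M1 -> M2 -> R) (W1 : M1) (W2 : M2) :=
  grad (L W1) W2.

(* [W3in k t] is the inner iterate, restarted from [W3 0] at every k. *)
Definition pbgd_jacobi (gamma alpha beta : R) (T : nat -> nat)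
    (W1 : nat -> M1) (W2 W3 : nat -> M2)
    (W3in : nat -> nat -> M2) : Prop :=
  forall k,
  [/\ W3in k 0%N = W3 0%N,
      forall t, (t < T k)%N ->
        W3in k t.+1 = W3in k t - beta *: gradW2 Ltrn (W1 k) (W3in k t),
      W3 k.+1 = W3in k (T k),
      W1 k.+1 = W1 k - alpha *: (gradW1 Lval (W1 k) (W2 k)
        + gamma *: (gradW1 Ltrn (W1 k) (W2 k)
                    - gradW1 Ltrn (W1 k) (W3 k.+1)))
    & W2 k.+1 = W2 k - alpha *: (gradW2 Lval (W1 k) (W2 k)
        + gamma *: gradW2 Ltrn (W1 k) (W2 k))].

Definition grad_error (gamma : R) (W1 : M1) (W3 : M2) : M1 :=
  gamma *: (grad Ltrn_star W1 - gradW1 Ltrn W1 W3).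

Definition local_smoothness (gamma alpha delta : R) (W1 : M1) (W2 : M2) : R :=
  let S := sigma_max (Xgamma gamma) ^+ 2 in
  let a := sigma_max W1 ^+ 2 + sigma_max W2 ^+ 2 in
  let G := Lgamma gamma W1 W2 - joint_min (Lgamma gamma) in
  S * a + 3 * alpha * delta * S * sigma_max W2
  + (1 + 3 * alpha * S * a) * Num.sqrt (2 * S * G)
  + 3 * alpha ^+ 2 * S * delta * sigma_max W1 * Num.sqrt (2 * S * G)
  + 6 * alpha ^+ 2 * S ^+ 2 * sigma_max (W1 *m W2) * G.

End Bilevel.

(* Main.v *)
Require Import Defs.
From HB Require Import structures.
From mathcomp Require Import all_boot all_order all_algebra.
From mathcomp Require Import all_classical all_reals all_analysis.
From mathcomp Require Import complex spectral ring lra.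
Import Order.TTheory GRing.Theory Num.Theory.
Import numFieldNormedType.Exports.

Set Implicit Arguments.
Unset Strict Implicit.
Unset Printing Implicit Defensive.

Local Open Scope classical_set_scope.
Local Open Scope ring_scope.

(** The penalised loss is a least-squares loss in disguise. Stacking the two
    data sets as [X_gamma = [X_val; sqrt gamma X_trn]] and likewise for the
    targets gives
      [L_gamma(W1, W2) = F(W1 W2) - gamma L*_trn(W1)],
      [F(W) = 1/2 |Y_gamma - X_gamma W|^2]  ([LgammaE]).
    Three facts make the correction term harmless.
    - Where [W1] has full row rank, [X_trn W1] can fit the training targets
      exactly, so [L*_trn(W1) = 0]. Full row rank is an open condition, hence
      [L*_trn] vanishes near [W1^k] and [L_gamma] has there the gradient of
      [F(W1 W2)] ([Ltrn_star_row_free], [row_free_near]).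
    - [L*_trn >= 0] everywhere, so [L_gamma <= F(W1 W2)] also at the next
      iterate, about whose rank nothing is known.
    - The infimum of [L_gamma] is [min F]: a point with lower-level gap [e]
      is compared with the [(0, e)] solution, whose training loss itself is at
      most [e] ([joint_min_Lgamma]).
    Everything then reduces to [F] composed with a matrix product.

    Let [P] be the gradient of [F] at [W = W1 W2]. The partial gradients of
    the composite are [P W2^T] and [W1^T P], so the joint PL inequality is the
    product of [|P W2^T|^2 + |W1^T P|^2 >=
    (sigma_min(W1)^2 + sigma_min(W2)^2) |P|^2] ([factor_grad_ge]) and of the PL
    inequality of least squares, [|P|^2 >= 2 sigma_*(X)^2 (F(W) - min F)]
    ([lsq_PL]). The latter holds because [P = X^T X Z] and
    [2 (F(W) - min F) = |X Z|^2], where [Z] is the distance to a minimiser.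

    For the descent inequality [F] is expanded exactly around [W]
    ([lsq_descent]). With [g1], [g2] the partial gradients and [d] the gradient
    error, the step changes [W] by [- alpha H + alpha^2 C], where
    [H = (g1 + d) W2 + W1 g2] and [C = (g1 + d) g2]. The first-order part gives
    [- alpha/2 |g|^2 + alpha/2 |d|^2]; the remaining terms are bounded using
    [|P| <= sqrt (2 S G)], with [S = sigma_max(X)^2] and [G = F(W) - min F],
    and the identity [C = P W^T P + d g2].

    All bounds by singular values come from one principle
    ([gram_roots_form_ge0]): an inequality
    [c0 |Z|^2 + c1 |A Z|^2 + c2 |A^T A Z|^2 >= 0] follows from
    [c0 + c1 a^2 + c2 a^4 >= 0] at each root [a] of the Gram matrix [A^T A]. *)

(** * The Frobenius inner product *)

Definition fdot (R : realType) p q (A B : 'M[R]_(p, q)) : R := \tr (A^T *m B).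

Lemma fdotE (R : realType) p q (A B : 'M[R]_(p, q)) :
  fdot A B = \sum_i \sum_j A i j * B i j.
Proof.
rewrite /fdot exchange_big; apply: eq_bigr => j _; rewrite mxE.
by apply: eq_bigr => i _; rewrite mxE.
Qed.

Lemma fnorm_sqr (R : realType) p q (A : 'M[R]_(p, q)) : fnorm A ^+ 2 = fdot A A.
Proof.
rewrite fdotE sqr_sqrtr.
  by apply: eq_bigr => i _; apply: eq_bigr => j _; rewrite expr2.
by apply: sumr_ge0 => i _; apply: sumr_ge0 => j _; exact: sqr_ge0.
Qed.

Lemma fnorm_ge0 (R : realType) p q (A : 'M[R]_(p, q)) : 0 <= fnorm A.
Proof. exact: sqrtr_ge0. Qed.

Lemma fnorm0 (R : realType) p q : fnorm (0 : 'M[R]_(p, q)) = 0.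
Proof.
rewrite /fnorm big1 ?sqrtr0 // => i _; rewrite big1 // => j _.
by rewrite mxE expr0n.
Qed.

Lemma fnorm_eq0 (R : realType) p q (A : 'M[R]_(p, q)) : fnorm A = 0 -> A = 0.
Proof.
move=> A0; have /eqP : fnorm A ^+ 2 = 0 by rewrite A0 expr0n.
rewrite fnorm_sqr fdotE psumr_eq0 => [/allP A00|i _]; last first.
  by apply: sumr_ge0 => j _; rewrite -expr2 sqr_ge0.
apply/matrixP => i j; rewrite mxE; have := A00 i (mem_index_enum _).
rewrite /= psumr_eq0 => [/allP/(_ j (mem_index_enum _))|j' _]; last first.
  by rewrite -expr2 sqr_ge0.
by rewrite /= mulf_eq0 orbb => /eqP.
Qed.

Lemma fdotC (R : realType) p q (A B : 'M[R]_(p, q)) : fdot A B = fdot B A.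
Proof. by rewrite /fdot -mxtrace_tr trmx_mul trmxK. Qed.

Lemma fdot_tr (R : realType) p q (A B : 'M[R]_(p, q)) :
  fdot A^T B^T = fdot A B.
Proof. by rewrite fdotC /fdot trmxK mxtrace_mulC. Qed.

Lemma fdotDr (R : realType) p q (A B C : 'M[R]_(p, q)) :
  fdot A (B + C) = fdot A B + fdot A C.
Proof. by rewrite /fdot mulmxDr mxtraceD. Qed.

Lemma fdotZr (R : realType) p q c (A B : 'M[R]_(p, q)) :
  fdot A (c *: B) = c * fdot A B.
Proof. by rewrite /fdot -scalemxAr mxtraceZ. Qed.

Lemma fdotNr (R : realType) p q (A B : 'M[R]_(p, q)) :
  fdot A (- B) = - fdot A B.
Proof. by rewrite -scaleN1r fdotZr mulN1r. Qed.

Lemma fdotDl (R : realType) p q (A B C : 'M[R]_(p, q)) :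
  fdot (A + B) C = fdot A C + fdot B C.
Proof. by rewrite fdotC fdotDr !(fdotC C). Qed.

Lemma fdotZl (R : realType) p q c (A B : 'M[R]_(p, q)) :
  fdot (c *: A) B = c * fdot A B.
Proof. by rewrite fdotC fdotZr fdotC. Qed.

Lemma fdotNl (R : realType) p q (A B : 'M[R]_(p, q)) :
  fdot (- A) B = - fdot A B.
Proof. by rewrite fdotC fdotNr fdotC. Qed.

(** Left multiplication by [X] has adjoint left multiplication by [X^T], and
    likewise on the right. Every gradient below is computed with these two
    rules. *)
Lemma fdot_mulmxl (R : realType) p q r (X : 'M[R]_(p, q)) A (B : 'M[R]_(p, r)) :
  fdot (X *m A) B = fdot A (X^T *m B).
Proof. by rewrite /fdot trmx_mul mulmxA. Qed.

Lemma fdot_mulmxr (R : realType) p q r (X : 'M[R]_(q, r)) A (B : 'M[R]_(p, r)) :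
  fdot (A *m X) B = fdot A (B *m X^T).
Proof. by rewrite /fdot trmx_mul -mulmxA mxtrace_mulC mulmxA. Qed.

Lemma fdot_delta (R : realType) p q (A : 'M[R]_(p, q)) i j :
  fdot A (delta_mx i j) = A i j.
Proof.
rewrite fdotE (bigD1 i) //= (bigD1 j) //= mxE !eqxx mulr1.
rewrite big1 ?addr0 => [|j' /negbTE j'j]; last by rewrite mxE j'j andbF mulr0.
rewrite big1 ?addr0 // => i' /negbTE i'i.
by rewrite big1 // => j' _; rewrite mxE i'i mulr0.
Qed.

Lemma fnorm_tr (R : realType) p q (A : 'M[R]_(p, q)) : fnorm A^T = fnorm A.
Proof.
by apply: (pexpIrn (_ : 0 < 2)%N); rewrite ?nnegrE ?fnorm_ge0 // !fnorm_sqr fdot_tr.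
Qed.

Lemma fnormZ (R : realType) p q c (A : 'M[R]_(p, q)) :
  fnorm (c *: A) = `|c| * fnorm A.
Proof.
apply: (pexpIrn (_ : 0 < 2)%N); rewrite ?nnegrE ?mulr_ge0 ?fnorm_ge0 //.
by rewrite exprMn !fnorm_sqr fdotZl fdotZr mulrA -expr2 real_normK ?num_real.
Qed.

Lemma fnormN (R : realType) p q (A : 'M[R]_(p, q)) : fnorm (- A) = fnorm A.
Proof. by rewrite -scaleN1r fnormZ normrN1 mul1r. Qed.

Lemma fnorm_sqrD (R : realType) p q (A B : 'M[R]_(p, q)) :
  fnorm (A + B) ^+ 2 = fnorm A ^+ 2 + 2 * fdot A B + fnorm B ^+ 2.
Proof.
rewrite !fnorm_sqr fdotDl !fdotDr (fdotC B A).
by rewrite mulr_natl mulr2n !addrA.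
Qed.

(** Cauchy-Schwarz, from [| |B| A - |A| B |^2 >= 0]. *)
Lemma fdot_le (R : realType) p q (A B : 'M[R]_(p, q)) :
  fdot A B <= fnorm A * fnorm B.
Proof.
have [A0|A0] := eqVneq (fnorm A) 0.
  by rewrite A0 (fnorm_eq0 A0) /fdot trmx0 mul0mx mxtrace0 mul0r.
have [B0|B0] := eqVneq (fnorm B) 0.
  by rewrite B0 (fnorm_eq0 B0) /fdot mulmx0 mxtrace0 mulr0.
have Agt0 : 0 < fnorm A by rewrite lt_def A0 fnorm_ge0.
have Bgt0 : 0 < fnorm B by rewrite lt_def B0 fnorm_ge0.
have := sqr_ge0 (fnorm (fnorm B *: A - fnorm A *: B)).
rewrite fnorm_sqrD fnormN !fnormZ !ger0_norm ?fnorm_ge0 //.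
rewrite fdotNr fdotZl fdotZr => h.
rewrite -subr_ge0 -(pmulr_rge0 _ (mulr_gt0 (ltr0Sn R 1) (mulr_gt0 Agt0 Bgt0))).
by rewrite (le_trans h) // le_eqVlt; apply/orP; left; apply/eqP; ring.
Qed.

Lemma norm_fdot_le (R : realType) p q (A B : 'M[R]_(p, q)) :
  `|fdot A B| <= fnorm A * fnorm B.
Proof.
by rewrite ler_norml fdot_le andbT lerNl -fdotNl -(fnormN A) fdot_le.
Qed.

Lemma fnorm_triangle (R : realType) p q (A B : 'M[R]_(p, q)) :
  fnorm (A + B) <= fnorm A + fnorm B.
Proof.
rewrite -(@ler_pXn2r _ 2) ?nnegrE ?addr_ge0 ?fnorm_ge0 //.
rewrite fnorm_sqrD sqrrD lerD2r lerD2l mulr_natl lerMn2r.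
exact: fdot_le.
Qed.

Lemma fnorm_sqr_rows (R : realType) p q (A : 'M[R]_(p, q)) :
  fnorm A ^+ 2 = \sum_i fnorm (row i A) ^+ 2.
Proof.
rewrite fnorm_sqr fdotE; apply: eq_bigr => i _.
rewrite fnorm_sqr fdotE big_ord1; apply: eq_bigr => j _.
by rewrite !mxE.
Qed.

(** Each entry of [A B] is the inner product of a row of [A] and a column of
    [B], so Cauchy-Schwarz bounds its square by the product of their squared
    norms; summing over the entries separates the two factors. *)
Lemma fnormM (R : realType) p q r (A : 'M[R]_(p, q)) (B : 'M[R]_(q, r)) :
  fnorm (A *m B) <= fnorm A * fnorm B.
Proof.
rewrite -(@ler_pXn2r _ 2) ?nnegrE ?mulr_ge0 ?fnorm_ge0 // exprMn.
rewrite -(fnorm_tr B) !(fnorm_sqr_rows A) (fnorm_sqr_rows B^T) mulr_suml.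
rewrite fnorm_sqr fdotE; apply: ler_sum => i _.
rewrite mulr_sumr; apply: ler_sum => j _.
have -> : (A *m B) i j = fdot (row i A) (row j B^T).
  by rewrite fdotE big_ord1 mxE; apply: eq_bigr => k _; rewrite !mxE.
rewrite -expr2 -exprMn -(real_normK (num_real (fdot _ _))).
by rewrite ler_pXn2r ?nnegrE ?mulr_ge0 ?fnorm_ge0 // norm_fdot_le.
Qed.

(** * Singular values *)

(** Sylvester's identity. Both sides come from the block matrix
    [M = [X, A; B, 1]]: eliminating the lower left block by the unit block
    gives [\det M = char_poly (A B)], eliminating it by the upper left block
    gives [X^q \det M = X^p char_poly (B A)]. It shows that [A^T A] and [A A^T]
    have the same nonzero eigenvalues with multiplicity. *)
Lemma char_poly_mulmxC (R : comNzRingType) p q (A : 'M[R]_(p, q)) (B : 'M[R]_(q, p)) :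
  'X^q * char_poly (A *m B) = 'X^p * char_poly (B *m A).
Proof.
pose a := map_mx polyC A; pose b := map_mx polyC B.
pose M := block_mx ('X%:M : 'M[{poly R}]_p) a b (1%:M : 'M[{poly R}]_q).
have EA : \det M = char_poly (A *m B).
  have := det_mulmx M (block_mx 1%:M 0 (- b) 1%:M).
  rewrite det_lblock !det1 !mulr1 => <-.
  rewrite mulmx_block !mulmx1 !mulmx0 !add0r mul1mx subrr det_ublock det1 mulr1.
  by rewrite mulmxN /char_poly /char_poly_mx map_mxM.
have EB : 'X^q * \det M = 'X^p * char_poly (B *m A).
  have := det_mulmx (block_mx 1%:M 0 (- b) 'X%:M) M.
  rewrite det_lblock det1 mul1r det_scalar => <-.
  rewrite mulmx_block !mul1mx !mul0mx !addr0 !mulmx1.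
  rewrite mulNmx -scalar_mxC addNr det_ublock det_scalar.
  by rewrite mulNmx addrC /char_poly /char_poly_mx map_mxM.
by rewrite -EA.
Qed.

Local Open Scope sesquilinear_scope.

Lemma conj_quadratic (F : comNzRingType) q (M U D V : 'M[F]_q) c0 c1 c2 :
    V *m U = 1%:M -> U *m V = 1%:M -> M = U *m D *m V ->
  c0%:M + c1 *: M + c2 *: (M *m M)
  = U *m (c0%:M + c1 *: D + c2 *: (D *m D)) *m V.
Proof.
move=> VU UV ->; rewrite 2!mulmxDr 2!mulmxDl; congr (_ + _ + _).
- by rewrite scalar_mxC -mulmxA UV mulmx1.
- by rewrite -scalemxAr -scalemxAl.
- rewrite -scalemxAr -scalemxAl; congr (_ *: _).
  by rewrite !mulmxA -[U *m D *m V *m U]mulmxA VU mulmx1.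
Qed.

(** The left-hand side of the conclusion is [\tr (Z^T Q Z)] with
    [Q = c0 + c1 M + c2 M^2] and [M = A^T A]. Over the complex numbers [M] is
    unitarily diagonalisable, its eigenvalues are the squares [a^2], and in the
    eigenbasis the trace is a sum of squared moduli weighted by
    [c0 + c1 a^2 + c2 a^4]. *)
Lemma gram_roots_form_ge0 (R : realType) p q r (A : 'M[R]_(p, q)) s c0 c1 c2
    (Z : 'M[R]_(q, r)) :
    gram_roots A s ->
    (forall a, a \in s -> 0 <= c0 + c1 * a ^+ 2 + c2 * (a ^+ 2) ^+ 2) ->
  0 <= c0 * fnorm Z ^+ 2 + c1 * fnorm (A *m Z) ^+ 2
       + c2 * fnorm (A^T *m A *m Z) ^+ 2.
Proof.
move=> [_ _ chA] s_ge0; set M := A^T *m A.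
have MT : M^T = M by rewrite trmx_mul trmxK.
pose Q : 'M[R]_q := c0%:M + c1 *: M + c2 *: (M *m M).
have -> : c0 * fnorm Z ^+ 2 + c1 * fnorm (A *m Z) ^+ 2
    + c2 * fnorm (M *m Z) ^+ 2 = \tr (Z^T *m (Q *m Z)).
  rewrite -/(fdot Z (Q *m Z)) !mulmxDl !fdotDr mul_scalar_mx -!scalemxAl !fdotZr.
  rewrite !fnorm_sqr; congr (_ + _ * _ + _ * _).
    by rewrite fdot_mulmxl mulmxA.
  by rewrite fdot_mulmxl MT mulmxA.
pose rc : {rmorphism R -> R[i]} := real_complex R.
pose B : 'M[R[i]]_q := map_mx rc M.
have conj_rc a b (U : 'M[R]_(a, b)) : (map_mx rc U)^t* = map_mx rc U^T.
  by apply/matrixP => i j; rewrite !mxE conj_Creal // complex_real.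
have Bh : B \is hermsymmx.
  by apply/is_hermitianmxP; rewrite expr0 scale1r conj_rc MT.
have BE := elimT (@orthomx_spectralP _ _ B) (hermitian_normalmx Bh).
have Pu : spectralmx B \is unitarymx := spectral_unitarymx B.
have Punit := unitarymx_unit Pu.
set P := spectralmx B in BE Pu Punit; set d := spectral_diag B in BE.
have dE i : exists2 a, a \in s & d 0 i = rc (a ^+ 2).
  have : root (char_poly B) (d 0 i).
    have -> : char_poly B = char_poly (diag_mx d).
      rewrite BE /char_poly /char_poly_mx !map_mxM /=.
      have VP : map_mx polyC (invmx P) *m map_mx polyC P = 1%:M.
        by rewrite -map_mxM mulVmx // map_mx1.
      have {1}-> : 'X%:M = map_mx polyC (invmx P) *m 'X%:M *m map_mx polyC P.
        by rewrite scalar_mxC -mulmxA VP mulmx1.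
      by rewrite -mulmxBl -mulmxBr !det_mulmx mulrAC -det_mulmx VP det1 mul1r.
    rewrite char_poly_trig ?diag_mx_is_trig // rootE horner_prod.
    apply/eqP/eqP/prodf_eq0; exists i => //=.
    by rewrite mxE eqxx mulr1n !hornerE subrr.
  rewrite -map_char_poly chA rmorph_prod /=.
  under eq_bigr do rewrite rmorphB /= map_polyX map_polyC /=.
  rewrite -(big_map (fun a : R => rc (a ^+ 2)) xpredT (fun x => 'X - x%:P)).
  by rewrite root_prod_XsubC => /mapP[a sa ->]; exists a.
pose e : 'rV[R[i]]_q := \row_i (rc c0 + rc c1 * d 0 i + rc c2 * (d 0 i) ^+ 2).
have e_ge0 i : 0 <= e 0 i.
  rewrite mxE; have [a sa ->] := dE i.
  by rewrite -rmorphXn -!rmorphM -!rmorphD /= lecR s_ge0.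
pose Y := P *m map_mx rc Z.
have QE : map_mx rc Q = P ^t* *m diag_mx e *m P.
  have DE : diag_mx e = (rc c0)%:M + rc c1 *: diag_mx d
      + rc c2 *: (diag_mx d *m diag_mx d).
    apply/matrixP => i j; rewrite mulmx_diag !mxE.
    case: eqVneq => [->|_]; rewrite ?mulr1n ?mulr0n ?mulr0 ?addr0 //.
  have -> : map_mx rc Q = (rc c0)%:M + rc c1 *: B + rc c2 *: (B *m B).
    by rewrite /B -map_mxM -!map_mxZ -map_scalar_mx -!map_mxD.
  rewrite DE -(invmx_unitary Pu).
  exact: (conj_quadratic _ _ _ (mulmxV Punit) (mulVmx Punit) BE).
have trE : rc (\tr (Z^T *m (Q *m Z))) = \tr (Y ^t* *m diag_mx e *m Y).
  rewrite -trace_map_mx 2!map_mxM QE -conj_rc /Y.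
  by rewrite trmx_mul map_mxM !mulmxA.
rewrite -lecR -/(rc _) -/(rc _) trE; clearbody Y e; apply: sumr_ge0 => i _.
rewrite mxE; apply: sumr_ge0 => k _; rewrite mul_mx_diag !mxE.
by rewrite mulrAC mulr_ge0 ?e_ge0 // mulrC mul_conjC_ge0.
Qed.

Local Close Scope sesquilinear_scope.

Lemma gram_roots_uniq (R : realType) p q (A : 'M[R]_(p, q)) s t :
  gram_roots A s -> gram_roots A t -> s = t.
Proof.
move=> [s_sorted /allP s_ge0 chs] [t_sorted /allP t_ge0 cht].
apply: (sorted_eq (@ge_trans _ R) _ s_sorted t_sorted).
  by move=> x y; rewrite /= andbC => /le_anti.
have sqrK (u : seq R) : (forall a, a \in u -> 0 <= a) ->
    [seq Num.sqrt x | x <- [seq a ^+ 2 | a <- u]] = u.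
  move=> u_ge0; rewrite -map_comp -[RHS]map_id; apply/eq_in_map => a ua /=.
  by rewrite sqrtr_sqr ger0_norm // u_ge0.
rewrite -(sqrK s s_ge0) -(sqrK t t_ge0); apply: perm_map.
apply: (@prod_XsubC_eq R).
by rewrite !big_map /= -chs -cht.
Qed.

Lemma size_gram_roots (R : realType) p q (A : 'M[R]_(p, q)) s :
  gram_roots A s -> size s = q.
Proof.
move=> [_ _ ch]; have := size_char_poly (A^T *m A).
by rewrite ch size_prod_XsubC => -[].
Qed.

(** By Sylvester's identity a wide matrix has the Gram roots of its transpose
    and [q - p] further zeros. *)
Lemma gram_roots_pad (R : realType) p q (A : 'M[R]_(p, q)) s :
  (p <= q)%N -> gram_roots A^T s -> gram_roots A (s ++ nseq (q - p) 0).
Proof.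
move=> pq [s_sorted s_ge0 ch]; split.
- rewrite sorted_pairwise ?pairwise_cat; last exact: ge_trans.
  rewrite -!sorted_pairwise ?s_sorted /=; try exact: ge_trans.
  apply/andP; split; last by elim: (q - p)%N => [|[|k]] //= ->; rewrite lexx.
  apply/allrelP => x y sx /nseqP[-> _] /=.
  by move/allP: s_ge0; exact.
- by rewrite all_cat s_ge0 all_nseq lexx orbT.
- have X0 : ('X^p : {poly R}) != 0 by rewrite monic_neq0 ?monicXn.
  apply: (mulfI X0); rewrite -char_poly_mulmxC.
  move: ch; rewrite trmxK => ->; rewrite big_cat /= mulrCA mulrC; congr (_ * _).
  rewrite big_nseq expr0n /= subr0.
  have -> : iter (q - p) ( *%R 'X) 1 = 'X^(q - p) :> {poly R}.
    by elim: (q - p)%N => //= k ->; rewrite -exprS.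
  by rewrite -exprD subnKC.
Qed.

Lemma singular_values_wide (R : realType) p q (A : 'M[R]_(p, q)) s :
  (p <= q)%N -> gram_roots A^T s -> singular_values A = s.
Proof.
move=> pq sA; have sA' := gram_roots_pad pq sA.
rewrite /singular_values (gram_roots_uniq (xgetPex [::] (gram_roots_ex A)) sA').
by rewrite (minn_idPl pq) -{1}(size_gram_roots sA) take_size_cat.
Qed.

Lemma singular_values_tall (R : realType) p q (A : 'M[R]_(p, q)) :
  (q <= p)%N -> gram_roots A (singular_values A).
Proof.
move=> qp; have sA := xgetPex [::] (gram_roots_ex A).
rewrite /singular_values (minn_idPr qp) take_oversize //.
by rewrite (size_gram_roots sA).
Qed.

Lemma singular_values_tr (R : realType) p q (A : 'M[R]_(p, q)) :
  singular_values A^T = singular_values A.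
Proof.
wlog pq : p q A / (p <= q)%N => [th|].
  have [|/ltnW qp] := leqP p q; first exact: th.
  by rewrite -(th _ _ A^T qp) trmxK.
by rewrite (singular_values_wide pq (singular_values_tall A^T pq)).
Qed.

(** No nonzero root of the Gram matrix is lost when the list is truncated to
    its first [minn p q] terms. Without this, [sigma_star] of a wide matrix
    could miss a smaller nonzero root. *)
Lemma gram_roots_singular_values (R : realType) p q (A : 'M[R]_(p, q)) :
  gram_roots A (singular_values A ++ nseq (q - p) 0).
Proof.
have [pq|/ltnW qp] := leqP p q.
  by rewrite -singular_values_tr; apply/gram_roots_pad/singular_values_tall.
move: (qp); rewrite -subn_eq0 => /eqP->; rewrite cats0.
exact: singular_values_tall.
Qed.

Lemma singular_values_ge0 (R : realType) p q (A : 'M[R]_(p, q)) a :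
  a \in singular_values A -> 0 <= a.
Proof.
move=> aA; have [_ /allP + _] := gram_roots_singular_values A.
by apply; rewrite mem_cat aA.
Qed.

Lemma sorted_singular_values (R : realType) p q (A : 'M[R]_(p, q)) :
  sorted >=%R (singular_values A).
Proof.
by have [/cat_sorted2[]] := gram_roots_singular_values A.
Qed.

Lemma size_singular_values (R : realType) p q (A : 'M[R]_(p, q)) :
  size (singular_values A) = minn p q.
Proof.
rewrite /singular_values size_takel //.
by rewrite (size_gram_roots (xgetPex [::] (gram_roots_ex A))) geq_minr.
Qed.

(** The constant coefficient must be nonnegative for a wide matrix only,
    because only then are there padding zeros among the Gram roots. *)
Lemma singular_values_form_ge0 (R : realType) p q r (A : 'M[R]_(p, q)) c0 c1 c2
    (Z : 'M[R]_(q, r)) :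
    (forall a, a \in singular_values A ->
      0 <= c0 + c1 * a ^+ 2 + c2 * (a ^+ 2) ^+ 2) ->
    (q <= p)%N || (0 <= c0) ->
  0 <= c0 * fnorm Z ^+ 2 + c1 * fnorm (A *m Z) ^+ 2
       + c2 * fnorm (A^T *m A *m Z) ^+ 2.
Proof.
move=> pos c0_ge0.
apply: (gram_roots_form_ge0 _ (gram_roots_singular_values A)) => a.
rewrite mem_cat => /orP[/pos//|/nseqP[-> qp]].
rewrite !expr0n /= !mulr0 !addr0.
by move: c0_ge0; rewrite -subn_eq0 gtn_eqF.
Qed.

Lemma sigma_max_ge0 (R : realType) p q (A : 'M[R]_(p, q)) : 0 <= sigma_max A.
Proof.
rewrite /sigma_max; have := @singular_values_ge0 _ _ _ A.
by case: (singular_values A) => // a s /(_ a); apply; rewrite mem_head.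
Qed.

Lemma le_sigma_max (R : realType) p q (A : 'M[R]_(p, q)) a :
  a \in singular_values A -> a <= sigma_max A.
Proof.
rewrite /sigma_max; have := sorted_singular_values A.
case: (singular_values A) => // b s; rewrite inE /=.
rewrite path_sortedE; last exact: ge_trans.
by move=> /andP[/allP s_le _] /predU1P[->//|/s_le].
Qed.

Lemma sigma_min_le (R : realType) p q (A : 'M[R]_(p, q)) a :
  a \in singular_values A -> sigma_min A <= a.
Proof.
rewrite /sigma_min -(size_singular_values A) => aA.
have sA := sorted_singular_values A.
have lt_a : (index a (singular_values A) < size (singular_values A))%N.
  by rewrite index_mem.
rewrite -[leRHS](nth_index 0 aA).
apply: (sorted_leq_nth (@ge_trans _ R) (@lexx _ R) 0 sA); rewrite ?inE //.
- by rewrite prednK // (leq_ltn_trans _ lt_a).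
- by rewrite -ltnS prednK // (leq_ltn_trans _ lt_a).
Qed.

Lemma sigma_min_ge0 (R : realType) p q (A : 'M[R]_(p, q)) : 0 <= sigma_min A.
Proof.
rewrite /sigma_min; have [lt_s|?] := ltnP (minn p q).-1 (size (singular_values A)).
  by apply: (@singular_values_ge0 _ _ _ A); rewrite mem_nth.
by rewrite nth_default.
Qed.

Lemma sigma_star_le (R : realType) p q (A : 'M[R]_(p, q)) a :
  a \in singular_values A -> a != 0 -> sigma_star A <= a.
Proof.
rewrite /sigma_star => aA a0.
have : a \in [seq b <- singular_values A | b != 0] by rewrite mem_filter a0.
have : sorted >=%R [seq b <- singular_values A | b != 0].
  exact: sorted_filter (@ge_trans _ R) _ _ (sorted_singular_values A).
case: (lastP [seq b <- singular_values A | b != 0]) => // s b.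
rewrite last_rcons mem_rcons inE.
rewrite sorted_pairwise; last exact: ge_trans.
rewrite pairwise_rcons => /andP[/allP s_le _] /predU1P[->//|/s_le] //.
Qed.

Lemma sigma_star_ge0 (R : realType) p q (A : 'M[R]_(p, q)) : 0 <= sigma_star A.
Proof.
rewrite /sigma_star.
have : all (>= 0) [seq b <- singular_values A | b != 0].
  by apply/allP => a; rewrite mem_filter => /andP[_ /singular_values_ge0].
case: (lastP [seq b <- singular_values A | b != 0]) => // s b.
by rewrite last_rcons all_rcons => /andP[].
Qed.

Lemma fnorm_mulmx_le (R : realType) p q r (A : 'M[R]_(p, q)) (Z : 'M[R]_(q, r)) :
  fnorm (A *m Z) <= sigma_max A * fnorm Z.
Proof.
rewrite -(@ler_pXn2r _ 2) ?nnegrE ?mulr_ge0 ?fnorm_ge0 ?sigma_max_ge0 //.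
rewrite exprMn -subr_ge0.
have := @singular_values_form_ge0 _ _ _ _ A (sigma_max A ^+ 2) (- 1) 0 Z.
rewrite mulN1r mul0r addr0; apply; last by rewrite sqr_ge0 orbT.
move=> a aA; rewrite mul0r addr0 mulN1r subr_ge0.
by rewrite ler_pXn2r ?nnegrE ?sigma_max_ge0 ?le_sigma_max ?(singular_values_ge0 aA).
Qed.

Lemma fnorm_mulmx_ge (R : realType) p q r (A : 'M[R]_(p, q)) (Z : 'M[R]_(q, r)) :
  (q <= p)%N -> sigma_min A * fnorm Z <= fnorm (A *m Z).
Proof.
move=> qp.
rewrite -(@ler_pXn2r _ 2) ?nnegrE ?mulr_ge0 ?fnorm_ge0 ?sigma_min_ge0 //.
rewrite exprMn -subr_ge0.
have := @singular_values_form_ge0 _ _ _ _ A (- sigma_min A ^+ 2) 1 0 Z.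
rewrite mul1r mul0r addr0 mulNr addrC; apply; last by rewrite qp.
move=> a aA; rewrite mul0r addr0 mul1r addrC subr_ge0.
by rewrite ler_pXn2r ?nnegrE ?sigma_min_ge0 ?sigma_min_le ?(singular_values_ge0 aA).
Qed.

(** Every eigenvalue [a^2] of [A^T A] is [0] or at least [sigma_star A ^+ 2], so
    [a^4 >= sigma_star A ^+ 2 * a^2] at all of them. This holds for any rank,
    since the component of [Z] in the kernel of [A] vanishes on both sides. *)
Lemma fnorm_gram_mulmx_ge (R : realType) p q r (A : 'M[R]_(p, q))
    (Z : 'M[R]_(q, r)) :
  sigma_star A * fnorm (A *m Z) <= fnorm (A^T *m (A *m Z)).
Proof.
rewrite -(@ler_pXn2r _ 2) ?nnegrE ?mulr_ge0 ?fnorm_ge0 ?sigma_star_ge0 //.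
rewrite exprMn -subr_ge0.
have := @singular_values_form_ge0 _ _ _ _ A 0 (- sigma_star A ^+ 2) 1 Z.
rewrite mul1r mul0r add0r mulNr addrC mulmxA; apply; last by rewrite lexx orbT.
move=> a aA; rewrite mul1r add0r mulNr addrC subr_ge0.
have [->|a0] := eqVneq a 0; first by rewrite !expr0n mulr0.
rewrite [leRHS]expr2 ler_wpM2r ?sqr_ge0 //.
by rewrite ler_pXn2r ?nnegrE ?sigma_star_ge0 ?sigma_star_le ?(singular_values_ge0 aA).
Qed.

Lemma sigma_max_tr (R : realType) p q (A : 'M[R]_(p, q)) :
  sigma_max A^T = sigma_max A.
Proof. by rewrite /sigma_max singular_values_tr. Qed.

Lemma sigma_min_tr (R : realType) p q (A : 'M[R]_(p, q)) :
  sigma_min A^T = sigma_min A.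
Proof. by rewrite /sigma_min singular_values_tr minnC. Qed.

Lemma fnorm_mulmxr_le (R : realType) p q r (A : 'M[R]_(p, q)) (Z : 'M[R]_(r, p)) :
  fnorm (Z *m A) <= fnorm Z * sigma_max A.
Proof.
by rewrite -fnorm_tr trmx_mul mulrC -(fnorm_tr Z) -sigma_max_tr fnorm_mulmx_le.
Qed.

(** * Least squares *)

Definition lsq (R : realType) p m n (X : 'M[R]_(p, m)) (Y : 'M[R]_(p, n)) W : R :=
  2^-1 * fnorm (Y - X *m W) ^+ 2.

Definition lsq_grad (R : realType) p m n (X : 'M[R]_(p, m)) (Y : 'M[R]_(p, n)) W :
    'M[R]_(m, n) :=
  X^T *m (X *m W - Y).

Lemma lsq_ge0 (R : realType) p m n (X : 'M[R]_(p, m)) (Y : 'M[R]_(p, n)) W :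
  0 <= lsq X Y W.
Proof. by rewrite mulr_ge0 ?invr_ge0 ?ler0n ?sqr_ge0. Qed.

Lemma lsqD (R : realType) p m n (X : 'M[R]_(p, m)) (Y : 'M[R]_(p, n)) W E :
  lsq X Y (W + E)
  = lsq X Y W + fdot (lsq_grad X Y W) E + 2^-1 * fnorm (X *m E) ^+ 2.
Proof.
rewrite /lsq mulmxDr opprD addrA (fnorm_sqrD (Y - X *m W)) fnormN fdotNr.
have -> : fdot (lsq_grad X Y W) E = - fdot (Y - X *m W) (X *m E).
  by rewrite [in RHS]fdotC fdot_mulmxl fdotC -fdotNr -mulmxN opprB fdotC.
by field.
Qed.

(** The normal equations [X^T X W = X^T Y] are always solvable: [X] and [X^T X]
    have the same kernel because [|X C|^2 = <C, X^T X C>], hence the same row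
    space. *)
Lemma lsq_stationary_ex (R : realType) p m n (X : 'M[R]_(p, m)) (Y : 'M[R]_(p, n)) :
  exists W, lsq_grad X Y W = 0.
Proof.
have /submxP[U XE] : (X <= X^T *m X)%MS.
  rewrite submxE; apply/eqP/fnorm_eq0/eqP; rewrite -sqrf_eq0 fnorm_sqr.
  by rewrite fdot_mulmxl mulmxA mulmx_coker /fdot mulmx0 mxtrace0.
have XtE : X^T = X^T *m X *m U^T by rewrite {1}XE !trmx_mul trmxK.
exists (U^T *m Y); rewrite /lsq_grad mulmxBr !mulmxA.
by rewrite -XtE subrr.
Qed.

Lemma lsq_stationary (R : realType) p m n (X : 'M[R]_(p, m)) (Y : 'M[R]_(p, n)) Ws W :
    lsq_grad X Y Ws = 0 ->
  2 * (lsq X Y W - lsq X Y Ws) = fnorm (X *m (W - Ws)) ^+ 2 /\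
  lsq_grad X Y W = X^T *m (X *m (W - Ws)).
Proof.
move=> Ws0; split.
  have := lsqD X Y Ws (W - Ws); rewrite addrC subrK Ws0 => ->.
  by rewrite /fdot trmx0 mul0mx mxtrace0; field.
rewrite -[LHS]subr0 -Ws0 -mulmxBr; congr (_ *m _).
by rewrite mulmxBr opprB addrA subrK.
Qed.

Lemma lsq_min_le (R : realType) p m n (X : 'M[R]_(p, m)) (Y : 'M[R]_(p, n)) Ws W :
  lsq_grad X Y Ws = 0 -> lsq X Y Ws <= lsq X Y W.
Proof.
move=> /(lsq_stationary W)[E _]; rewrite -subr_ge0 -(pmulr_rge0 _ (ltr0Sn R 1)).
by rewrite E sqr_ge0.
Qed.

Lemma lsq_PL (R : realType) p m n (X : 'M[R]_(p, m)) (Y : 'M[R]_(p, n)) Ws W :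
    lsq_grad X Y Ws = 0 ->
  sigma_star X ^+ 2 * (2 * (lsq X Y W - lsq X Y Ws))
  <= fnorm (lsq_grad X Y W) ^+ 2.
Proof.
move=> /(lsq_stationary W)[-> ->]; rewrite -exprMn.
by rewrite ler_pXn2r ?nnegrE ?mulr_ge0 ?fnorm_ge0 ?sigma_star_ge0 ?fnorm_gram_mulmx_ge.
Qed.

Lemma lsq_grad_le (R : realType) p m n (X : 'M[R]_(p, m)) (Y : 'M[R]_(p, n)) Ws W :
    lsq_grad X Y Ws = 0 ->
  fnorm (lsq_grad X Y W)
  <= Num.sqrt (2 * sigma_max X ^+ 2 * (lsq X Y W - lsq X Y Ws)).
Proof.
move=> /(lsq_stationary W)[E ->]; rewrite mulrAC E -exprMn sqrtr_sqr.
rewrite ger0_norm ?mulr_ge0 ?fnorm_ge0 ?sigma_max_ge0 // mulrC -sigma_max_tr.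
exact: fnorm_mulmx_le.
Qed.

(** [W1^T] and [W2] are tall, so each stretches every matrix by at least its
    smallest singular value; for [W1] this uses that transposition preserves
    singular values. *)
Lemma factor_grad_ge (R : realType) m h n (A : 'M[R]_(m, h)) (B : 'M[R]_(h, n))
    (P : 'M[R]_(m, n)) :
    (m <= h)%N -> (n <= h)%N ->
  (sigma_min A ^+ 2 + sigma_min B ^+ 2) * fnorm P ^+ 2
  <= fnorm (P *m B^T) ^+ 2 + fnorm (A^T *m P) ^+ 2.
Proof.
move=> mh nh; rewrite mulrDl addrC -!exprMn; apply: lerD.
- rewrite -(fnorm_tr (P *m _)) trmx_mul trmxK -(fnorm_tr P).
  by rewrite ler_pXn2r ?nnegrE ?mulr_ge0 ?fnorm_ge0 ?sigma_min_ge0 ?fnorm_mulmx_ge.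
- rewrite -sigma_min_tr.
  by rewrite ler_pXn2r ?nnegrE ?mulr_ge0 ?fnorm_ge0 ?sigma_min_ge0 ?fnorm_mulmx_ge.
Qed.

(** The bookkeeping of the descent estimate. The letters stand for
    [n1 = |g1|], [Q = |g2|], [D = |g1 + d|], [h = |H|], [c = |C|],
    [dot = <g1, g1 + d>], [P] for the linear term and [xe] for twice the
    quadratic term of the expansion of the loss. Everything beyond the
    first-order terms is bounded by a multiple of
    [K = |g1|^2 + |g2|^2 + |d|^2]. *)
Lemma descent_scalar_ineq (R : realFieldType) (F alpha S a G delta s1 s2 sW q n1 Q D h c
    dot P xe K : R) :
    0 <= alpha -> 0 <= S -> 0 <= a -> 0 <= G -> 0 <= delta -> 0 <= s1 -> 0 <= s2 ->
    0 <= sW -> 0 <= q -> 0 <= n1 -> 0 <= Q -> 0 <= D -> 0 <= h -> 0 <= c ->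
    a = s1 ^+ 2 + s2 ^+ 2 -> q ^+ 2 = 2 * S * G ->
    K = n1 ^+ 2 + Q ^+ 2 + delta ^+ 2 ->
    n1 <= q * s2 -> Q <= s1 * q -> D <= n1 + delta -> h <= s2 * D + s1 * Q ->
    c <= D * Q -> c <= q * (sW * q) + delta * Q ->
    2 * dot = n1 ^+ 2 + D ^+ 2 - delta ^+ 2 ->
    D ^+ 2 <= 2 * (n1 ^+ 2 + delta ^+ 2) ->
    P <= - alpha * (dot + Q ^+ 2) + alpha ^+ 2 * (q * c) ->
    xe <= S * (alpha * h + alpha ^+ 2 * c) ^+ 2 ->
  let L := S * a + 3 * alpha * delta * S * s2
    + (1 + 3 * alpha * S * a) * q + 3 * alpha ^+ 2 * S * delta * s1 * q
    + 6 * alpha ^+ 2 * S ^+ 2 * sW * G in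
  is_true (F + P + 2^-1 * xe
  <= F - (alpha / 2 - alpha ^+ 2 * L) * (n1 ^+ 2 + Q ^+ 2)
     + (alpha / 2 + alpha ^+ 2 * L) * delta ^+ 2).
Proof.
move=> alpha_ge0 S_ge0 a_ge0 G_ge0 delta_ge0 s1_ge0 s2_ge0 sW_ge0 q_ge0 n1_ge0.
move=> Q_ge0 D_ge0 h_ge0 c_ge0 aE q2 KE n1_le Q_le D_le h_le c_DQ c_le dotE D2.
move=> P_le xe_le L.
have K_ge0 : 0 <= K by rewrite KE !addr_ge0 ?sqr_ge0.
have DQ2 : D ^+ 2 + Q ^+ 2 <= 2 * K by have := sqr_ge0 Q; rewrite KE; lra.
have c_K : c <= K by have := sqr_ge0 (D - Q); rewrite sqrrB; lra.
(* Cauchy-Schwarz for the pairs (s2, s1) and (D, Q). *)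
have h2 : h ^+ 2 <= 2 * a * K.
  apply: (@le_trans _ _ ((s2 * D + s1 * Q) ^+ 2)).
    by rewrite ler_pXn2r ?nnegrE ?addr_ge0 ?mulr_ge0.
  apply: (@le_trans _ _ (a * (D ^+ 2 + Q ^+ 2))).
    have := sqr_ge0 (s2 * Q - s1 * D); rewrite aE; nra.
  by rewrite (mulrC 2 a) -mulrA ler_wpM2l.
have h_lin : h <= a * q + delta * s2.
  apply: (le_trans h_le); rewrite aE.
  have e1 : s2 * D <= s2 * (q * s2 + delta) by rewrite ler_wpM2l //; lra.
  have e2 : s1 * Q <= s1 * (s1 * q) by rewrite ler_wpM2l.
  by lra.
have c_lin : c <= 2 * S * G * sW + delta * s1 * q.
  have e1 : delta * Q <= delta * (s1 * q) by rewrite ler_wpM2l.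
  by rewrite -q2; lra.
have hc : h * c <= (a * q + delta * s2) * K by rewrite ler_pM.
have cc : c ^+ 2 <= (2 * S * G * sW + delta * s1 * q) * K by rewrite expr2 ler_pM.
have e1 : (alpha ^+ 2 * S) * h ^+ 2 <= (alpha ^+ 2 * S) * (2 * a * K).
  by rewrite ler_wpM2l // mulr_ge0 ?exprn_ge0.
have e2 : (alpha ^+ 3 * S) * (h * c) <= (alpha ^+ 3 * S) * ((a * q + delta * s2) * K).
  by rewrite ler_wpM2l // mulr_ge0 ?exprn_ge0.
have e3 : (alpha ^+ 4 * S) * c ^+ 2
    <= (alpha ^+ 4 * S) * ((2 * S * G * sW + delta * s1 * q) * K).
  by rewrite ler_wpM2l // mulr_ge0 ?exprn_ge0.
have e4 : (alpha ^+ 2 * q) * c <= (alpha ^+ 2 * q) * K.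
  by rewrite ler_wpM2l // mulr_ge0 ?exprn_ge0.
(* The final comparison is linear in the monomials. [f1] to [f4] are, up
   to constants, the parts of [L] in excess of the bounds [e1] to [e4]; [f5] and
   [f6] are the unused part of the first-order decrease. *)
have f1 : 0 <= alpha ^+ 3 * delta * S * s2 * K by rewrite !mulr_ge0 ?exprn_ge0.
have f2 : 0 <= alpha ^+ 3 * S * a * q * K by rewrite !mulr_ge0 ?exprn_ge0.
have f3 : 0 <= alpha ^+ 4 * S * delta * s1 * q * K by rewrite !mulr_ge0 ?exprn_ge0.
have f4 : 0 <= alpha ^+ 4 * S ^+ 2 * sW * G * K by rewrite !mulr_ge0 ?exprn_ge0.
have f5 : 0 <= alpha * D ^+ 2 by rewrite mulr_ge0 ?sqr_ge0.
have f6 : 0 <= alpha * Q ^+ 2 by rewrite mulr_ge0 ?sqr_ge0.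
have P_le' : P <= - alpha / 2 * (n1 ^+ 2 + D ^+ 2 - delta ^+ 2) - alpha * Q ^+ 2
    + alpha ^+ 2 * q * c by rewrite -dotE; lra.
have -> : F - (alpha / 2 - alpha ^+ 2 * L) * (n1 ^+ 2 + Q ^+ 2)
     + (alpha / 2 + alpha ^+ 2 * L) * delta ^+ 2
  = F - alpha / 2 * (n1 ^+ 2 + Q ^+ 2) + alpha / 2 * delta ^+ 2 + alpha ^+ 2 * L * K.
  by rewrite KE; ring.
rewrite /L; lra.
Qed.

(** The first-order terms use [2 <g1, g1 + d> = |g1|^2 + |g1 + d|^2 - |d|^2].
    Products such as [|H| |C|] have too high an order in the gradients; one
    factor is turned into a constant by [|H| <= a q + delta s2] and
    [|C| <= sW q^2 + delta s1 q] with [q = sqrt (2 S G)], the other is at most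
    [K]. *)
Lemma lsq_descent (R : realType) p m h n (X : 'M[R]_(p, m)) (Y : 'M[R]_(p, n))
    (A d : 'M[R]_(m, h)) (B : 'M[R]_(h, n)) Ws alpha :
  lsq_grad X Y Ws = 0 -> 0 < alpha ->
  let P := lsq_grad X Y (A *m B) in
  let g1 := P *m B^T in
  let g2 := A^T *m P in
  let S := sigma_max X ^+ 2 in
  let a := sigma_max A ^+ 2 + sigma_max B ^+ 2 in
  let G := lsq X Y (A *m B) - lsq X Y Ws in
  let delta := fnorm d in
  let L := S * a + 3 * alpha * delta * S * sigma_max B
    + (1 + 3 * alpha * S * a) * Num.sqrt (2 * S * G)
    + 3 * alpha ^+ 2 * S * delta * sigma_max A * Num.sqrt (2 * S * G)
    + 6 * alpha ^+ 2 * S ^+ 2 * sigma_max (A *m B) * G in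
  is_true (lsq X Y ((A - alpha *: (g1 + d)) *m (B - alpha *: g2))
  <= lsq X Y (A *m B)
     - (alpha / 2 - alpha ^+ 2 * L) * (fnorm g1 ^+ 2 + fnorm g2 ^+ 2)
     + (alpha / 2 + alpha ^+ 2 * L) * delta ^+ 2).
Proof.
move=> Ws0 alpha_gt0 P g1 g2 S a G delta L.
have alpha_ge0 := ltW alpha_gt0.
pose H := (g1 + d) *m B + A *m g2; pose C := (g1 + d) *m g2.
have -> : (A - alpha *: (g1 + d)) *m (B - alpha *: g2)
    = A *m B + (- alpha *: H + alpha ^+ 2 *: C).
  rewrite mulmxBl !mulmxBr -!scalemxAl -!scalemxAr scalerA -expr2 /H /C.
  rewrite opprB scaleNr scalerDr opprD addrCA -!addrA.
  by rewrite addrC -!addrA; congr (_ + _); rewrite addrCA.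
rewrite lsqD -/P.
set q := Num.sqrt (2 * S * G) in L *; set s1 := sigma_max A in a L *.
set s2 := sigma_max B in a L *; set sW := sigma_max (A *m B) in L *.
pose D := fnorm (g1 + d); pose Q := fnorm g2; pose n1 := fnorm g1.
pose K := n1 ^+ 2 + Q ^+ 2 + delta ^+ 2.
have S_ge0 : 0 <= S by exact: sqr_ge0.
have G_ge0 : 0 <= G by rewrite subr_ge0 lsq_min_le.
have q_ge0 : 0 <= q by exact: sqrtr_ge0.
have q2 : q ^+ 2 = 2 * S * G by rewrite /q sqr_sqrtr // mulr_ge0 // mulr_ge0 // ler0n.
have s1_ge0 : 0 <= s1 by exact: sigma_max_ge0.
have s2_ge0 : 0 <= s2 by exact: sigma_max_ge0.
have sW_ge0 : 0 <= sW by exact: sigma_max_ge0.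
have D_ge0 : 0 <= D by exact: fnorm_ge0.
have Q_ge0 : 0 <= Q by exact: fnorm_ge0.
have n1_ge0 : 0 <= n1 by exact: fnorm_ge0.
have delta_ge0 : 0 <= delta by exact: fnorm_ge0.
have a_ge0 : 0 <= a by rewrite addr_ge0 ?sqr_ge0.
have K_ge0 : 0 <= K by rewrite !addr_ge0 ?sqr_ge0.
have P_le : fnorm P <= q by exact: lsq_grad_le.
have n1_le : n1 <= q * s2.
  rewrite /n1 /s2 -sigma_max_tr (le_trans (fnorm_mulmxr_le _ _)) //.
  by rewrite ler_wpM2r ?sigma_max_ge0.
have Q_le : Q <= s1 * q.
  rewrite /Q /s1 -sigma_max_tr (le_trans (fnorm_mulmx_le _ _)) //.
  by rewrite ler_wpM2l ?sigma_max_ge0.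
have D_le : D <= n1 + delta by exact: fnorm_triangle.
have H_le : fnorm H <= s2 * D + s1 * Q.
  rewrite (le_trans (fnorm_triangle _ _)) // lerD ?fnorm_mulmx_le //.
  by rewrite mulrC fnorm_mulmxr_le.
have C_le : fnorm C <= D * Q by exact: fnormM.
have C_le' : fnorm C <= q * (sW * q) + delta * Q.
  have -> : C = P *m ((A *m B)^T *m P) + d *m g2.
    by rewrite /C mulmxDl /g1 /g2 trmx_mul !mulmxA.
  rewrite (le_trans (fnorm_triangle _ _)) // lerD ?fnormM //.
  rewrite (le_trans (fnormM _ _)) // ler_pM ?fnorm_ge0 //.
  rewrite (le_trans (fnorm_mulmx_le _ _)) // sigma_max_tr.
  by rewrite ler_wpM2l.
have dot_g1 : 2 * fdot g1 (g1 + d) = n1 ^+ 2 + D ^+ 2 - delta ^+ 2.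
  rewrite /n1 /D /delta fnorm_sqrD fdotDr -fnorm_sqr; ring.
have D2 : D ^+ 2 <= 2 * (n1 ^+ 2 + delta ^+ 2).
  by have := sqr_ge0 (n1 - delta); rewrite -subr_ge0; nra.
have dotE : fdot P (- alpha *: H + alpha ^+ 2 *: C)
    <= - alpha * (fdot g1 (g1 + d) + Q ^+ 2) + alpha ^+ 2 * (q * fnorm C).
  rewrite fdotDr !fdotZr lerD //.
    have -> : fdot g1 (g1 + d) = fdot P ((g1 + d) *m B).
      by rewrite fdotC [RHS]fdotC fdot_mulmxr.
    have -> : Q ^+ 2 = fdot P (A *m g2).
      by rewrite /Q fnorm_sqr [RHS]fdotC fdot_mulmxl.
    by rewrite fdotDr.
  rewrite ler_wpM2l ?sqr_ge0 // (le_trans (fdot_le _ _)) //.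
  by rewrite ler_wpM2r ?fnorm_ge0.
have XE : fnorm (X *m (- alpha *: H + alpha ^+ 2 *: C)) ^+ 2
    <= S * (alpha * fnorm H + alpha ^+ 2 * fnorm C) ^+ 2.
  rewrite -exprMn ler_pXn2r ?nnegrE ?fnorm_ge0 //; last first.
    by rewrite mulr_ge0 ?sigma_max_ge0 ?addr_ge0 ?mulr_ge0 ?fnorm_ge0 ?sqr_ge0.
  rewrite (le_trans (fnorm_mulmx_le _ _)) // ler_wpM2l ?sigma_max_ge0 //.
  rewrite (le_trans (fnorm_triangle _ _)) // !fnormZ normrN.
  by rewrite !ger0_norm ?sqr_ge0.
exact: (descent_scalar_ineq (lsq X Y (A *m B)) alpha_ge0 S_ge0 a_ge0 G_ge0 delta_ge0
  s1_ge0 s2_ge0 sW_ge0 q_ge0 n1_ge0 Q_ge0 D_ge0 (fnorm_ge0 H) (fnorm_ge0 C)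
  (erefl a) q2 (erefl K) n1_le Q_le D_le H_le C_le C_le' dot_g1 D2 dotE XE).
Qed.

(** * Gradients of the losses *)

(** The expansion is required only near [0] along each line, so that it applies
    to losses that are quadratic merely in a neighbourhood of [A]. *)
Lemma gradE (R : realType) p q (f : 'M[R]_(p, q) -> R) A G (r : 'M[R]_(p, q) -> R) :
    (forall V, \forall t \near (0 : R),
       f (t *: V + A) = f A + t * fdot G V + t ^+ 2 * r V) ->
  grad f A = G.
Proof.
move=> fE; apply/matrixP => i j; rewrite mxE -fdot_delta; set V := delta_mx i j.
apply: cvg_lim => //.
have : (fun t : R => fdot G V + t * r V : R^o) @ 0^' --> (fdot G V : R^o).
  rewrite -[X in _ --> X]addr0; apply: cvgD; first exact: cvg_cst.
  rewrite -[X in _ --> X](mul0r (r V)); apply: cvgMl.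
  exact: cvg_within.
apply: cvg_trans; apply: near_eq_cvg; near=> t => /=.
have t0 : t != 0 by near: t; exact: nbhs_dnbhs_neq.
have -> : f (t *: V + A) = f A + t * fdot G V + t ^+ 2 * r V.
  by near: t; apply: cvg_within; exact: fE.
rewrite /GRing.scale /=; field.
Unshelve. all: by end_near. Qed.

Lemma grad_lsq_left (R : realType) p m h n (X : 'M[R]_(p, m)) (Y : 'M[R]_(p, n))
    (f : 'M[R]_(m, h) -> R) (A : 'M[R]_(m, h)) (B : 'M[R]_(h, n)) :
    (forall V, \forall t \near (0 : R),
       f (t *: V + A) = lsq X Y ((t *: V + A) *m B)) ->
  grad f A = lsq_grad X Y (A *m B) *m B^T.
Proof.
move=> fE; apply: (@gradE _ _ _ _ _ _ (fun V => 2^-1 * fnorm (X *m (V *m B)) ^+ 2)).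
move=> V; have fA : f A = lsq X Y (A *m B).
  by have := nbhs_singleton (fE 0); rewrite scaler0 add0r.
apply: filterS (fE V) => t ->; rewrite mulmxDl addrC lsqD fA -scalemxAl fdotZr.
rewrite -scalemxAr fnormZ exprMn real_normK ?num_real //.
by rewrite [fdot (_ *m B^T) V]fdot_mulmxr trmxK mulrCA.
Qed.

Lemma grad_lsq_right (R : realType) p m h n (X : 'M[R]_(p, m)) (Y : 'M[R]_(p, n))
    (f : 'M[R]_(h, n) -> R) (A : 'M[R]_(m, h)) (B : 'M[R]_(h, n)) :
    (forall V, \forall t \near (0 : R),
       f (t *: V + B) = lsq X Y (A *m (t *: V + B))) ->
  grad f B = A^T *m lsq_grad X Y (A *m B).
Proof.
move=> fE; apply: (@gradE _ _ _ _ _ _ (fun V => 2^-1 * fnorm (X *m (A *m V)) ^+ 2)).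
move=> V; have fB : f B = lsq X Y (A *m B).
  by have := nbhs_singleton (fE 0); rewrite scaler0 add0r.
apply: filterS (fE V) => t ->; rewrite mulmxDr addrC lsqD fB -scalemxAr fdotZr.
rewrite -scalemxAr fnormZ exprMn real_normK ?num_real //.
by rewrite [fdot (A^T *m _) V]fdot_mulmxl trmxK mulrCA.
Qed.

(** If [B (E + A) = 0] then [sigma_min A |B| <= |B A| = |B E| <= |B| |E|], which
    forces [B = 0]. *)
Lemma row_free_perturb (R : realType) m h (A E : 'M[R]_(m, h)) :
  (m <= h)%N -> fnorm E < sigma_min A -> row_free (E + A).
Proof.
move=> mh EA; rewrite -kermx_eq0; apply/eqP; set B := kermx _.
have : B *m A = - (B *m E).
  by apply/eqP; rewrite -addr_eq0 -mulmxDr addrC mulmx_ker.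
move=> /(congr1 (@fnorm _ _ _)); rewrite fnormN => BE.
have := fnorm_mulmx_ge A^T B^T mh; rewrite sigma_min_tr -trmx_mul !fnorm_tr BE.
move=> /le_trans/(_ (fnormM _ _)); rewrite mulrC => B_le.
apply: fnorm_eq0; apply/eqP; rewrite eq_le fnorm_ge0 andbT leNgt.
by apply/negP => B_gt0; move: B_le; rewrite ler_pM2l // leNgt EA.
Qed.

Lemma row_free_sigma_min (R : realType) m h (A : 'M[R]_(m, h)) :
  (m <= h)%N -> 0 < sigma_min A -> row_free A.
Proof.
move=> mh A_gt0; rewrite -[A]add0r row_free_perturb //.
by rewrite fnorm0.
Qed.

Lemma row_free_near (R : realType) m h (A V : 'M[R]_(m, h)) :
    (m <= h)%N -> 0 < sigma_min A ->
  \forall t \near (0 : R), row_free (t *: V + A).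
Proof.
move=> mh A_gt0.
(* The 1 avoids a case distinction on [V = 0]. *)
have e_gt0 : 0 < sigma_min A / (1 + fnorm V).
  by rewrite divr_gt0 // ltr_pwDl ?fnorm_ge0.
apply: filterS (nbhs0_lt e_gt0) => t; rewrite ltr_pdivlMr ?ltr_pwDl ?fnorm_ge0 //.
move=> t_lt; apply: row_free_perturb => //; rewrite fnormZ.
by apply: le_lt_trans t_lt; rewrite ler_wpM2l // lerDr.
Qed.

Lemma factor_ex (R : realType) m h n (W : 'M[R]_(m, n)) :
  (m <= h)%N -> exists A B, W = (A : 'M[R]_(m, h)) *m (B : 'M[R]_(h, n)).
Proof.
move=> mh; exists (pid_mx m), (pid_mx m *m W).
by rewrite mulmxA pid_mx_id // pid_mx_1 mul1mx.
Qed.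

Lemma LtrnE (R : realType) N N' m n h (D : bilevel_data R N N' m n)
    (A : 'M[R]_(m, h)) B :
  Ltrn D A B = lsq (Xtrn D) (Ytrn D) (A *m B).
Proof. by rewrite /Ltrn /lsq mulmxA. Qed.

Lemma LvalE (R : realType) N N' m n h (D : bilevel_data R N N' m n)
    (A : 'M[R]_(m, h)) B :
  Lval D A B = lsq (Xval D) (Yval D) (A *m B).
Proof. by rewrite /Lval /lsq mulmxA. Qed.

Lemma Ltrn_ge0 (R : realType) N N' m n h (D : bilevel_data R N N' m n)
    (A : 'M[R]_(m, h)) B : 0 <= Ltrn D A B.
Proof. by rewrite LtrnE lsq_ge0. Qed.

Lemma Ltrn_star_ge0 (R : realType) N N' m n h (D : bilevel_data R N N' m n)
    (A : 'M[R]_(m, h)) : 0 <= Ltrn_star D A.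
Proof.
apply: lb_le_inf; first by exists (Ltrn D A 0); exists 0.
by move=> _ [B _ <-]; exact: Ltrn_ge0.
Qed.

Lemma Ltrn_star_le (R : realType) N N' m n h (D : bilevel_data R N N' m n)
    (A : 'M[R]_(m, h)) B : Ltrn_star D A <= Ltrn D A B.
Proof.
apply: ge_inf; last by exists B.
by exists 0 => _ [B' _ <-]; exact: Ltrn_ge0.
Qed.

(** The training targets can be fitted exactly: apply a right inverse of [Xtrn],
    then one of [A]. *)
Lemma Ltrn_star_row_free (R : realType) N N' m n h (D : bilevel_data R N N' m n)
    (A : 'M[R]_(m, h)) :
  row_free (Xtrn D) -> row_free A -> Ltrn_star D A = 0.
Proof.
move=> Xfree Afree; apply/eqP; rewrite eq_le Ltrn_star_ge0 andbT.
apply: le_trans (Ltrn_star_le _ _ (pinvmx A *m (pinvmx (Xtrn D) *m Ytrn D))) _.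
rewrite LtrnE /lsq (mulmxA A) mulmxVp // mul1mx mulmxA mulmxVp // mul1mx subrr.
by rewrite fnorm0 expr0n mulr0.
Qed.

Lemma grad_Ltrn_star (R : realType) N N' m n h (D : bilevel_data R N N' m n)
    (A : 'M[R]_(m, h)) :
    (m <= h)%N -> row_free (Xtrn D) -> 0 < sigma_min A ->
  grad (Ltrn_star D) A = 0.
Proof.
move=> mh Xfree A_gt0; apply: (@gradE _ _ _ _ _ _ (fun=> 0)) => V.
apply: filterS (row_free_near V mh A_gt0) => t free_t.
rewrite !Ltrn_star_row_free // ?/fdot ?trmx0 ?mul0mx ?mxtrace0 ?mulr0 ?addr0 //.
exact: row_free_sigma_min.
Qed.

(** * Reduction of the penalised loss to least squares *)

Definition Ygamma (R : realType) N N' m n (D : bilevel_data R N N' m n) gamma :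
    'M[R]_(N' + N, n) :=
  col_mx (Yval D) (Num.sqrt gamma *: Ytrn D).

Lemma fnorm_sqr_col_mx (R : realType) p q r (A : 'M[R]_(p, r)) (B : 'M[R]_(q, r)) :
  fnorm (col_mx A B) ^+ 2 = fnorm A ^+ 2 + fnorm B ^+ 2.
Proof. by rewrite !fnorm_sqr /fdot tr_col_mx mul_row_col mxtraceD. Qed.

Lemma lsq_gammaE (R : realType) N N' m n (D : bilevel_data R N N' m n) gamma W :
    0 <= gamma ->
  lsq (Xgamma D gamma) (Ygamma D gamma) W
  = lsq (Xval D) (Yval D) W + gamma * lsq (Xtrn D) (Ytrn D) W.
Proof.
move=> gamma_ge0; rewrite /lsq mul_col_mx opp_col_mx add_col_mx fnorm_sqr_col_mx.
rewrite -scalemxAl -scalerBr fnormZ exprMn real_normK ?num_real // (sqr_sqrtr gamma_ge0).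
by ring.
Qed.

Lemma lsq_grad_gammaE (R : realType) N N' m n (D : bilevel_data R N N' m n) gamma W :
    0 <= gamma ->
  lsq_grad (Xgamma D gamma) (Ygamma D gamma) W
  = lsq_grad (Xval D) (Yval D) W + gamma *: lsq_grad (Xtrn D) (Ytrn D) W.
Proof.
move=> gamma_ge0; rewrite /lsq_grad mul_col_mx opp_col_mx add_col_mx tr_col_mx.
rewrite mul_row_col -scalemxAl -scalerBr [(_ *: _)^T]linearZ /=.
by rewrite -scalemxAl -scalemxAr scalerA -expr2 sqr_sqrtr.
Qed.

Lemma LgammaE (R : realType) N N' m n h (D : bilevel_data R N N' m n) gamma
    (A : 'M[R]_(m, h)) B :
    0 <= gamma ->
  Lgamma D gamma A B
  = lsq (Xgamma D gamma) (Ygamma D gamma) (A *m B) - gamma * Ltrn_star D A.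
Proof.
by move=> gamma_ge0; rewrite /Lgamma LvalE LtrnE lsq_gammaE // mulrBr addrA.
Qed.

(** [<=] holds because every [Ws] factors through [m <= h] inner dimensions and
    [L_gamma <= F(W1 W2)]. For [>=], let [eps] be the lower-level gap of
    [(A, B)]. The [(0, eps)] solution has no larger validation loss, and its
    training loss is at most [eps], the smallest training loss being [0]; so
    [F] there is at most [L_gamma(A, B)]. The gap of the solution alone would
    not suffice: at a rank-deficient [W1] it can be small while the training
    loss is large. *)
Lemma joint_min_Lgamma (R : realType) N N' m n h (D : bilevel_data R N N' m n)
    gamma Ws :
    (m <= h)%N -> row_free (Xtrn D) -> 0 <= gamma ->
    (forall eps, 0 <= eps ->
       exists (W1s : 'M[R]_(m, h)) (W2s : 'M[R]_(h, n)),
         eps_solution D 0 eps W1s W2s /\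
         Ltrn D W1s W2s - joint_min (@Ltrn R N N' m n h D) <= eps) ->
    lsq_grad (Xgamma D gamma) (Ygamma D gamma) Ws = 0 ->
  joint_min (@Lgamma R N N' m n h D gamma)
  = lsq (Xgamma D gamma) (Ygamma D gamma) Ws.
Proof.
move=> mh Xfree gamma_ge0 solvable Ws0; apply/eqP; rewrite eq_le; apply/andP; split.
  have [A [B WsE]] := factor_ex Ws mh.
  apply: (@le_trans _ _ (Lgamma D gamma A B)); last first.
    by rewrite LgammaE // -WsE gerBl mulr_ge0 ?Ltrn_star_ge0.
  apply: ge_inf; last by exists (A, B).
  exists 0 => _ [[A' B'] _ <-] /=.
  rewrite addr_ge0 ?LvalE ?lsq_ge0 // mulr_ge0 // subr_ge0; exact: Ltrn_star_le.
apply: lb_le_inf; first by exists (Lgamma D gamma (0 : 'M[R]_(m, h)) 0); exists (0, 0).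
move=> _ [[A B] _ <-] /=.
have jm0 : joint_min (@Ltrn R N N' m n h D) <= 0.
  have [A0 [B0 E0]] := factor_ex (pinvmx (Xtrn D) *m Ytrn D) mh.
  apply: (@le_trans _ _ (Ltrn D A0 B0)).
    apply: ge_inf; last by exists (A0, B0).
    by exists 0 => _ [[A' B'] _ <-] /=; exact: Ltrn_ge0.
  rewrite LtrnE -E0 /lsq mulmxA mulmxVp // mul1mx subrr.
  by rewrite fnorm0 expr0n mulr0.
have eps_ge0 : 0 <= Ltrn D A B - Ltrn_star D A by rewrite subr_ge0 Ltrn_star_le.
have [As [Bs [[_ As_opt] As_trn]]] := solvable _ eps_ge0.
have := As_opt A B (lexx _); rewrite addr0 => val_le.
apply: (le_trans (lsq_min_le (As *m Bs) Ws0)).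
rewrite lsq_gammaE // -LvalE -LtrnE /Lgamma lerD // ler_wpM2l //.
by apply: le_trans As_trn; rewrite -{1}[Ltrn D As Bs]subr0 lerB.
Qed.

Lemma gradW1_Lval (R : realType) N N' m n h (D : bilevel_data R N N' m n)
    (A : 'M[R]_(m, h)) B :
  gradW1 (@Lval _ _ _ _ _ _ D) A B
  = lsq_grad (Xval D) (Yval D) (A *m B) *m B^T.
Proof.
apply: grad_lsq_left => V; apply: (filterS _ (nbhs0_lt ltr01)) => t _.
exact: LvalE.
Qed.

Lemma gradW1_Ltrn (R : realType) N N' m n h (D : bilevel_data R N N' m n)
    (A : 'M[R]_(m, h)) B :
  gradW1 (@Ltrn _ _ _ _ _ _ D) A B
  = lsq_grad (Xtrn D) (Ytrn D) (A *m B) *m B^T.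
Proof.
apply: grad_lsq_left => V; apply: (filterS _ (nbhs0_lt ltr01)) => t _.
exact: LtrnE.
Qed.

Lemma gradW2_Lval (R : realType) N N' m n h (D : bilevel_data R N N' m n)
    (A : 'M[R]_(m, h)) B :
  gradW2 (@Lval _ _ _ _ _ _ D) A B
  = A^T *m lsq_grad (Xval D) (Yval D) (A *m B).
Proof.
apply: grad_lsq_right => V; apply: (filterS _ (nbhs0_lt ltr01)) => t _.
exact: LvalE.
Qed.

Lemma gradW2_Ltrn (R : realType) N N' m n h (D : bilevel_data R N N' m n)
    (A : 'M[R]_(m, h)) B :
  gradW2 (@Ltrn _ _ _ _ _ _ D) A B
  = A^T *m lsq_grad (Xtrn D) (Ytrn D) (A *m B).
Proof.
apply: grad_lsq_right => V; apply: (filterS _ (nbhs0_lt ltr01)) => t _.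
exact: LtrnE.
Qed.

Theorem lemma1 (R : realType) (N N' m n h : nat)
  (D : bilevel_data R N N' m n) (gamma alpha beta : R) (T : nat -> nat)
  (W1 : nat -> 'M[R]_(m, h)) (W2 W3 : nat -> 'M[R]_(h, n))
  (W3in : nat -> nat -> 'M[R]_(h, n))
  (hm : (maxn N N' <= m)%N) (hh : (maxn m n <= h)%N)
  (rank_trn : row_free (Xtrn D)) (rank_val : row_free (Xval D))
  (gamma_gt0 : 0 < gamma) (alpha_gt0 : 0 < alpha) (beta_gt0 : 0 < beta)
  (solvable : forall eps1 eps2 : R, 0 <= eps1 -> 0 <= eps2 ->
     exists (W1s : 'M[R]_(m, h)) (W2s : 'M[R]_(h, n)),
       eps_solution D eps1 eps2 W1s W2s /\
       Ltrn D W1s W2s - joint_min (@Ltrn R N N' m n h D) <= eps2)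
  (iterates : pbgd_jacobi D gamma alpha beta T W1 W2 W3 W3in)
  (k : nat)
  (W1_pos : 0 < sigma_min (W1 k) ^+ 2) (W2_pos : 0 < sigma_min (W2 k) ^+ 2) :
  let L := @Lgamma R N N' m n h D gamma in
  let mu := (sigma_min (W1 k) ^+ 2 + sigma_min (W2 k) ^+ 2)
            * sigma_star (Xgamma D gamma) ^+ 2 in
  let delta := fnorm (grad_error D gamma (W1 k) (W3 k.+1)) in
  let Lk := local_smoothness D gamma alpha delta (W1 k) (W2 k) in
  joint_grad_sqnorm L (W1 k) (W2 k)
    >= 2 * mu * (L (W1 k) (W2 k) - joint_min L)
  /\
  L (W1 k.+1) (W2 k.+1)
    <= L (W1 k) (W2 k)
       - (alpha / 2 - alpha ^+ 2 * Lk) * joint_grad_sqnorm L (W1 k) (W2 k)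
       + (alpha / 2 + alpha ^+ 2 * Lk) * delta ^+ 2.
Proof.
have mh : (m <= h)%N := leq_trans (leq_maxl m n) hh.
have nh : (n <= h)%N := leq_trans (leq_maxr m n) hh.
have gamma_ge0 := ltW gamma_gt0.
have W1_gt0 : 0 < sigma_min (W1 k).
  by rewrite lt_def sigma_min_ge0 andbT -sqrf_eq0 gt_eqF.
move=> L mu delta Lk.
set A := W1 k in W1_pos W1_gt0 mu delta Lk *.
set B := W2 k in W2_pos mu Lk *.
set Xg := Xgamma D gamma in mu *; pose Yg := Ygamma D gamma.
have [Ws Ws0] := lsq_stationary_ex Xg Yg.
have L_min : joint_min L = lsq Xg Yg Ws.
  by apply: joint_min_Lgamma => // eps; exact: solvable.
have L_AB : L A B = lsq Xg Yg (A *m B).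
  rewrite /L LgammaE // (Ltrn_star_row_free rank_trn) ?mulr0 ?subr0 //.
  exact: row_free_sigma_min.
pose P := lsq_grad Xg Yg (A *m B).
have gA : grad (fun A' => L A' B) A = P *m B^T.
  apply: grad_lsq_left => V.
  apply: filterS (row_free_near V mh W1_gt0) => t free_t.
  by rewrite /L LgammaE // (Ltrn_star_row_free rank_trn) // mulr0 subr0.
have gB : grad (L A) B = A^T *m P.
  apply: grad_lsq_right => V; apply: (filterS _ (nbhs0_lt ltr01)) => t _.
  rewrite /L LgammaE // (Ltrn_star_row_free rank_trn) ?mulr0 ?subr0 //.
  exact: row_free_sigma_min.
rewrite /joint_grad_sqnorm gA gB L_AB L_min; split.
  apply: le_trans (factor_grad_ge _ _ _ mh nh).
  rewrite /mu mulrAC mulrC -[leLHS]mulrA ler_wpM2l ?addr_ge0 ?sqr_ge0 //.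
  by rewrite lsq_PL.
have [_ _ _ -> ->] := iterates k.
pose d := grad_error D gamma A (W3 k.+1).
have dE : d = - (gamma *: gradW1 (@Ltrn _ _ _ _ _ _ D) A (W3 k.+1)).
  by rewrite /d /grad_error grad_Ltrn_star // sub0r scalerN.
have PE : P = lsq_grad (Xval D) (Yval D) (A *m B)
    + gamma *: lsq_grad (Xtrn D) (Ytrn D) (A *m B) by exact: lsq_grad_gammaE.
rewrite -/A -/B scalerBr addrA -dE.
have -> : gradW1 (@Lval _ _ _ _ _ _ D) A B
    + gamma *: gradW1 (@Ltrn _ _ _ _ _ _ D) A B = P *m B^T.
  by rewrite gradW1_Lval gradW1_Ltrn PE mulmxDl scalemxAl.
have -> : gradW2 (@Lval _ _ _ _ _ _ D) A B
    + gamma *: gradW2 (@Ltrn _ _ _ _ _ _ D) A B = A^T *m P.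
  by rewrite gradW2_Lval gradW2_Ltrn PE mulmxDr scalemxAr.
(* The next iterate may lose rank, so only an inequality is available there. *)
have L_le U V : L U V <= lsq Xg Yg (U *m V).
  by rewrite /L LgammaE // gerBl mulr_ge0 ?Ltrn_star_ge0.
apply: (le_trans (L_le _ _)).
have := lsq_descent A d B Ws0 alpha_gt0.
by rewrite /Lk /local_smoothness -/L L_min L_AB.
Qed.
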